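(* Let $H\in\mathbb{N}$, $\alpha\in\mathbb{R}$, and let $\mathcal{L}_\infty$, $\mathcal{G}$, $V$, $\langle\cdot,\cdot\rangle$ be as in the context. Let $\mathcal{V}_1,\mathcal{V}_2\in C(\mathbb{R}^{3H+1},\mathbb{R})$ satisfy for all $\phi=(\phi_1,\dots,\phi_{3H+1})\in\mathbb{R}^{3H+1}$ that $$\mathcal{V}_1(\phi)=(\phi_{3H+1})^2-2\alpha\phi_{3H+1}+\sum_{j=1}^{H}(\phi_{2H+j})^2,\qquad \mathcal{V}_2(\phi)=(\phi_{3H+1})^2-2\alpha\phi_{3H+1}+\sum_{j=1}^{H}\big[(\phi_j)^2+(\phi_{H+j})^2\big].$$ Let $\phi\in\mathbb{R}^{3H+1}$. Then (i) $\langle(\nabla\mathcal{V}_1)(\phi),\mathcal{G}(\phi)\rangle=4\mathcal{L}_\infty(\phi)$; (ii) $\langle(\nabla\mathcal{V}_2)(\phi),\mathcal{G}(\phi)\rangle=4\mathcal{L}_\infty(\phi)$; and (iii) $\langle(\nabla V)(\phi),\mathcal{G}(\phi)\rangle=8\mathcal{L}_\infty(\phi)$.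
   Context: $\mathbb{N}=\{1,2,\dots\}$. Fix $H\in\mathbb{N}$, $\alpha\in\mathbb{R}$. For $r\in[1,\infty)$, $x\in\mathbb{R}$ let $\sigma_r(x)=r^{-1}\ln(1+r^{-1}e^{rx})$, and let $\sigma_\infty(x)=\max\{x,0\}$. For $r\in[1,\infty]$, $\phi=(\phi_1,\dots,\phi_{3H+1})\in\mathbb{R}^{3H+1}$, $x\in\mathbb{R}$ let $\mathscr{N}_r^{\phi}(x)=\phi_{3H+1}+\sum_{j=1}^{H}\phi_{2H+j}\,\sigma_r(\phi_jx+\phi_{H+j})$ and $\mathcal{L}_r(\phi)=\int_0^1(\mathscr{N}_r^{\phi}(y)-\alpha)^2\,dy$. The function $\mathcal{G}\colon\mathbb{R}^{3H+1}\to\mathbb{R}^{3H+1}$ satisfies $\mathcal{G}(\phi)=\lim_{r\to\infty}(\nabla\mathcal{L}_r)(\phi)$ for every $\phi$ for which the sequence $((\nabla\mathcal{L}_r)(\phi))_{r\in\mathbb{N}}$ converges. $\|\cdot\|$ and $\langle\cdot,\cdot\rangle$ are the Euclidean norm and inner product. $V\colon\mathbb{R}^{3H+1}\to\mathbb{R}$ is given by $V(\phi)=\|\phi\|^2+(\phi_{3H+1}-2\alpha)^2$. *)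

(* Defs.v *)
From HB Require Import structures.
From mathcomp Require Import all_boot all_order all_algebra.
From mathcomp Require Import all_classical all_reals all_analysis.
Set Implicit Arguments.
Unset Strict Implicit.
Unset Printing Implicit Defensive.
Import Order.TTheory GRing.Theory Num.Theory.
Import numFieldNormedType.Exports.
Local Open Scope classical_set_scope.
Local Open Scope ring_scope.

(* The norm [`|u|] that MathComp-Analysis puts on ['rV[R]_n] is the sup norm,
   so the Euclidean structure is defined separately. *)
Definition inner (R : realType) (n : nat) (u v : 'rV[R]_n) : R :=
  \sum_(i < n) u 0 i * v 0 i.

Definition enorm (R : realType) (n : nat) (u : 'rV[R]_n) : R :=
  Num.sqrt (inner u u).

(* [delta_mx 0 i] is the i-th standard basis vector. *)
Definition grad (R : realType) (n : nat) (f : 'rV[R]_n -> R) (u : 'rV[R]_n) :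
    'rV[R]_n :=
  \row_(i < n) 'D_(delta_mx 0 i) f u.

(* Coordinates numbered from 1: [coordinate u k] is u_k for 1 <= k <= n + 1. *)
Definition coordinate (R : realType) (n : nat) (u : 'rV[R]_n.+1) (k : nat) :
    R :=
  u 0 (inord k.-1).

(* The index r ranges over [1, +oo]; the value at [-oo] is a dummy. *)
Definition activation (R : realType) (r : \bar R) (x : R) : R :=
  match r with
  | s%:E => s^-1 * ln (1 + s^-1 * expR (s * x))
  | +oo%E => Num.max x 0
  | -oo%E => 0
  end.

Definition network (R : realType) (H : nat) (r : \bar R)
    (phi : 'rV[R]_(3 * H).+1) (x : R) : R :=
  coordinate phi (3 * H + 1)
  + \sum_(1 <= j < H.+1) coordinate phi (2 * H + j)
      * activation r (coordinate phi j * x + coordinate phi (H + j)).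

Definition risk (R : realType) (H : nat) (alpha : R) (r : \bar R)
    (phi : 'rV[R]_(3 * H).+1) : R :=
  \int[lebesgue_measure]_(y in `[0, 1]) (network r phi y - alpha) ^+ 2.

Definition lyapunov (R : realType) (H : nat) (alpha : R)
    (phi : 'rV[R]_(3 * H).+1) : R :=
  enorm phi ^+ 2 + (coordinate phi (3 * H + 1) - 2 * alpha) ^+ 2.

(* The sequence of gradients runs over the indices r = 1, 2, 3, ... *)
Definition generalized_gradient (R : realType) (H : nat) (alpha : R)
    (G : 'rV[R]_(3 * H).+1 -> 'rV[R]_(3 * H).+1) : Prop :=
  forall phi : 'rV[R]_(3 * H).+1,
    let g := fun n : nat => grad (risk alpha (n.+1%:R)%:E) phi in
    cvgn g -> G phi = limn g.

(* Main.v *)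
Require Import Defs.
From mathcomp Require Import all_boot all_order all_algebra.
From mathcomp Require Import all_classical all_reals all_analysis.
From mathcomp Require Import measurable_realfun ring lra zify.
Import Order.TTheory GRing.Theory Num.Theory.
Import numFieldNormedType.Exports.
Local Open Scope classical_set_scope.
Local Open Scope ring_scope.

(* The gradients of the smooth risks converge at every phi: differentiating
   under the integral, their directional derivative along v is the integral of
   [2 (N_r - alpha) DN_r(v)], and by dominated convergence this tends to the
   same expression A(v) with [r = +oo], where the derivative of the ReLU is
   taken to be the indicator of x > 0. Hence <u, G phi> = A(u) by linearity. The
   homogeneity identity 1_{x > 0} x = max(x, 0) gives
   [DN(u) = (a + b) (N - alpha)] as soon as u scales the outer weights by a, the
   inner weights and biases by b, and replaces the outer bias c by
   [(a + b) (c - alpha)]; the three gradients of the theorem have this form. *)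

(** * Limits of sequences and derivatives along lines *)

Section calculus.
Context {R : realType}.

Lemma cvg_invSn : ((n.+1%:R : R)^-1) @[n --> \oo] --> (0 : R).
Proof. exact: (@cvg_harmonic R). Qed.

Lemma cvg_dist_le (u w : nat -> R) (l K : R) :
  (forall n, `|u n - l| <= K * w n) -> w @ \oo --> 0 -> u @ \oo --> l.
Proof.
move=> uw w0.
have Kw0 : K * w n @[n --> \oo] --> 0.
  by rewrite -(mulr0 K); apply: cvgM => //; exact: cvg_cst.
have d0 : `|u n - l| @[n --> \oo] --> 0.
  apply: (@squeeze_cvgr _ _ _ _ (cst 0) _ _ _ _ _ Kw0); last exact: cvg_cst.
  by apply: nearW => n /=; rewrite normr_ge0/= uw.
by apply/subr_cvg0; apply: norm_cvg0.
Qed.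

Lemma cvg_sumr {W : normedModType R} (I : Type) (l : seq I) (u : I -> nat -> W)
    (a : I -> W) :
  (forall i, u i n @[n --> \oo] --> a i) ->
  \sum_(i <- l) u i n @[n --> \oo] --> \sum_(i <- l) a i.
Proof.
move=> ua; elim: l => [|i l ih].
  by under eq_fun do rewrite big_nil; rewrite big_nil; exact: cvg_cst.
by under eq_fun do rewrite big_cons; rewrite big_cons; exact: cvgD.
Qed.

(** Both sides are limits of the same difference quotient. This turns every partial derivative below
    into one-variable calculus. *)
Lemma derive_line {W : normedModType R} (f : W -> R) (x v : W) :
  'D_v f x = 'D_1 (fun t : R => f (t *: v + x)) 0.
Proof.
rewrite /derive; set u := (X in X @ _); set w := (X in _ = lim (X @ _)).
suff -> : u = w by [].
by apply/funext => h; rewrite /u /w /= addr0 scaler1 scale0r add0r.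
Qed.

Lemma is_derive_bigsum (I : Type) (l : seq I) (F : I -> R -> R) (dF : I -> R) (x : R) :
  (forall i, is_derive x 1 (F i) (dF i)) ->
  is_derive x 1 (fun t => \sum_(i <- l) F i t) (\sum_(i <- l) dF i).
Proof.
move=> dFi; elim: l => [|i l ih].
  by under eq_fun do rewrite big_nil; rewrite big_nil; exact: is_derive_cst.
under eq_fun do rewrite big_cons; rewrite big_cons.
exact: is_deriveD.
Qed.

Lemma is_derive_affine (a b x : R) : is_derive x 1 (fun t : R => t * a + b) a.
Proof.
rewrite (_ : (fun t => _) = a \*: (id : R -> R) + cst b).
  apply: (is_derive_eq (is_deriveD
    (is_deriveZ a (is_derive_id x (1 : R))) (is_derive_cst b x 1))).
  by rewrite /GRing.scale/= mulr1 addr0.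
by apply/funext => t; rewrite !fctE /GRing.scale/= mulrC.
Qed.

End calculus.

(** * The softplus-type activations and their limits *)

Section activation.
Context {R : realType}.
Implicit Types (s x : R) (r : \bar R) (n : nat).

(* At [+oo] this is the left derivative: it vanishes at the kink, where it is
   the limit of the derivatives at finite indices. *)
Definition dactivation r x : R :=
  match r with
  | s%:E => expR (s * x) / (s + expR (s * x))
  | +oo%E => (0 < x)%R%:R
  | -oo%E => 0
  end.

Lemma is_derive_activation s x : 0 < s ->
  is_derive x 1 (activation s%:E) (dactivation s%:E x).
Proof.
move=> s0; have s_neq0 : s != 0 by rewrite gt_eqF.
have e0 : 0 < expR (s * x) by exact: expR_gt0.
have d1 : is_derive x (1 : R) (fun y : R => s * y) s.
  apply: (@is_derive_eq _ _ _ (s \*: (id : R -> R)) _ _ _ (s *: 1)).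
  by rewrite /GRing.scale/= mulr1.
have d2 : is_derive x (1 : R) (fun y : R => expR (s * y)) (expR (s * x) * s).
  exact: (@is_derive1_comp _ expR (fun y : R => s * y)).
have d3 : is_derive x (1 : R) (fun y : R => 1 + s^-1 * expR (s * y)) (expR (s * x)).
  apply: (@is_derive_eq _ _ _
    (cst 1 + s^-1 \*: (fun y : R => expR (s * y))) _ _ _
    (0 + s^-1 *: (expR (s * x) * s))).
  by rewrite /GRing.scale/=; field.
have p0 : 0 < 1 + s^-1 * expR (s * x) by rewrite addr_gt0// mulr_gt0// invr_gt0.
have d4 : is_derive x (1 : R) (fun y : R => ln (1 + s^-1 * expR (s * y)))
   ((1 + s^-1 * expR (s * x))^-1 * expR (s * x)).
  by apply: (@is_derive1_comp _ (@ln R)) => //; exact: is_derive1_ln.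
apply: (@is_derive_eq _ _ _
    (s^-1 \*: (fun y : R => ln (1 + s^-1 * expR (s * y)))) _ _ _
    (s^-1 *: ((1 + s^-1 * expR (s * x))^-1 * expR (s * x)))).
rewrite /GRing.scale/=; field.
by rewrite s_neq0/= gt_eqF//= addr_gt0.
Qed.

Lemma dactivation_ge0_le1 s x : 0 < s -> 0 <= dactivation s%:E x <= 1.
Proof.
move=> s0 /=; have e0 : 0 < expR (s * x) by exact: expR_gt0.
have p0 : 0 < s + expR (s * x) by rewrite addr_gt0.
apply/andP; split; first by rewrite divr_ge0// ltW.
by rewrite ler_pdivrMr// mul1r lerDr ltW.
Qed.

(** For x <= 0, kink included, the exponential is at most 1 and the quotient at most 1/s. For x > 0
    the defect from 1 is s / (s + e^(sx)), which a quadratic lower bound on the exponential makes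
    O(1/s). *)
Lemma cvg_dactivation x :
  dactivation (n.+1%:R)%:E x @[n --> \oo] --> dactivation +oo%E x.
Proof.
have [x0|x0] := ltP 0 x; last first.
  apply: (@cvg_dist_le _ _ (fun n => n.+1%:R^-1) _ 1); last exact: cvg_invSn.
  move=> n /=; rewrite ltNge x0 subr0 mul1r.
  set s : R := n.+1%:R; have s0 : 0 < s by rewrite ltr0n.
  have e0 := expR_gt0 (s * x).
  have e1 : expR (s * x) <= 1 by rewrite expR_le1 mulr_ge0_le0// ltW.
  have se0 : 0 < s + expR (s * x) by rewrite addr_gt0.
  rewrite ger0_norm; last by rewrite divr_ge0// ltW.
  have se1 : 0 < s^-1 * expR (s * x) by rewrite mulr_gt0// invr_gt0.
  by rewrite ler_pdivrMr// mulrDr mulVf ?gt_eqF// (le_trans e1)// lerDl ltW.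
apply: (@cvg_dist_le _ _ (fun n => n.+1%:R^-1) _ (4 / x ^+ 2)); last exact: cvg_invSn.
move=> n /=; rewrite x0; set s : R := n.+1%:R.
have s0 : 0 < s by rewrite ltr0n.
have e0 := expR_gt0 (s * x).
have -> : expR (s * x) / (s + expR (s * x)) - 1 = - (s / (s + expR (s * x))).
  by field; rewrite gt_eqF// addr_gt0.
have se0 : 0 < s + expR (s * x) by rewrite addr_gt0.
rewrite normrN ger0_norm; last by rewrite divr_ge0// ltW.
rewrite ler_pdivrMr//.
(* Square e^t >= 1 + t at t = sx/2; a lower bound linear in s would not make the defect tend to
   0. *)
have e2 : (s * x / 2) ^+ 2 <= expR (s * x).
  have -> : s * x = s * x / 2 + s * x / 2 by lra.
  rewrite expRD -expr2 (_ : s * x / 2 + s * x / 2 = s * x); last by lra.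
  rewrite ler_sqr ?nnegrE ?expR_ge0 ?divr_ge0 ?mulr_ge0 ?ltW//.
  by have := expR_ge1Dx (s * x / 2); lra.
apply: (@le_trans _ _ (4 / x ^+ 2 / s * (s * x / 2) ^+ 2)).
  by rewrite le_eqVlt; apply/orP; left; apply/eqP; field; rewrite !gt_eqF.
by rewrite ler_wpM2l ?invr_ge0 ?divr_ge0 ?sqr_ge0 ?(ltW s0)//; lra.
Qed.

(** With m = max(x, 0), the quantity ln(1 + e^(sx)/s) lies between sm - ln s and sm + 1. With q =
    sqrt s >= 1, ln s = 2 ln q <= 2q, so the error is at most 3q before division by s = q^2. The
    bound is uniform in x. *)
Lemma activation_dist s x : 1 <= s ->
  `|activation s%:E x - activation +oo%E x| <= 3 / Num.sqrt s.
Proof.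
move=> s1 /=; have s0 : 0 < s by lra.
set q := Num.sqrt s; have q0 : 0 < q by rewrite sqrtr_gt0.
have sq : s = q ^+ 2 by rewrite sqr_sqrtr// ltW.
have q1 : 1 <= q by rewrite -sqrtr1 ler_wsqrtr.
set m := Num.max x 0.
have m0 : 0 <= m by rewrite le_max lexx orbT.
have xm : x <= m by rewrite le_max lexx.
set E := expR (s * x); have E0 : 0 < E by exact: expR_gt0.
have sV0 : 0 < s^-1 by rewrite invr_gt0.
have sV1 : s^-1 <= 1 by rewrite invf_le1.
have sE0 : 0 < s^-1 * E by rewrite mulr_gt0.
have lnP : 0 <= ln (1 + s^-1 * E) by apply: ln_ge0; rewrite lerDl ltW.
have lns : ln s <= 2 * q.
  by rewrite sq lnXn// mulr2n; have := ln_sublinear q0; lra.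
have lo1 : s * x - ln s <= ln (1 + s^-1 * E).
  rewrite -(expRK (s * x)) -/E addrC -lnV ?posrE// -lnM ?posrE//.
  by rewrite ler_ln ?posrE ?addr_gt0// lerDr.
have lo : s * m - ln s <= ln (1 + s^-1 * E).
  rewrite /m; case: (leP x 0) => x0 //.
  by rewrite mulr0 sub0r (le_trans _ lnP)// oppr_le0 ln_ge0.
have ln2 : ln (2 : R) <= 1 by have := @le_ln1Dx R 1; lra.
(* Both 1 and e^(sx)/s are at most e^(sm), so the argument is at most 2 e^(sm), and ln 2 <= 1. *)
have hi : ln (1 + s^-1 * E) <= 1 + s * m.
  have EM : E <= expR (s * m) by rewrite ler_expR ler_wpM2l// ltW.
  have M1 : 1 <= expR (s * m) by rewrite -expR0 ler_expR mulr_ge0// ltW.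
  apply: (@le_trans _ _ (ln (2 * expR (s * m)))); last first.
    by rewrite lnM ?posrE ?expR_gt0// expRK lerD2r.
  rewrite ler_ln ?posrE ?addr_gt0 ?mulr_gt0 ?expR_gt0//.
  have : s^-1 * E <= 1 * expR (s * m) by rewrite ler_pM// ltW.
  lra.
have -> : 3 / q = s^-1 * (3 * q) by rewrite sq; field; rewrite gt_eqF.
rewrite (_ : m = s^-1 * (s * m)); last by field; rewrite gt_eqF.
rewrite -mulrBr normrM (gtr0_norm sV0) ler_wpM2l ?(ltW sV0)// ler_norml.
apply/andP; split; lra.
Qed.

Lemma cvg_activation x :
  activation (n.+1%:R)%:E x @[n --> \oo] --> activation +oo%E x.
Proof.
apply: (@cvg_dist_le _ _ (fun n => (Num.sqrt (n.+1%:R : R))^-1) _ 3).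
  by move=> n; apply: activation_dist; rewrite ler1n.
have : Num.sqrt ((n.+1%:R : R)^-1) @[n --> \oo] --> Num.sqrt (0 : R).
  by apply: continuous_cvg; [exact: sqrt_continuous | exact: cvg_invSn].
by rewrite sqrtr0; under eq_fun do rewrite sqrtrV ?ler0n//.
Qed.

(** The constant does not depend on [s]; this is what gives majorants valid for all indices at
    once. *)
Lemma activation_le s x : 1 <= s -> `|activation s%:E x| <= `|x| + 3.
Proof.
move=> s1; have := activation_dist s x s1.
have : 3 / Num.sqrt s <= 3.
  rewrite ler_pdivrMr ?sqrtr_gt0 ?(lt_le_trans _ s1)// ler_peMr//.
  by rewrite -sqrtr1 ler_wsqrtr.
have : `|activation +oo%E x| <= `|x|.
  rewrite /= /Num.max; case: ifP => _ //; by rewrite normr0.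
set a := activation s%:E x; set b := activation +oo%E x => h1 h2 h3.
have := ler_normD (a - b) b; rewrite subrK; lra.
Qed.

Lemma measurable_activation r : measurable_fun setT (activation r).
Proof.
case: r => [s||]; last exact: measurable_cst.
  apply: measurable_funM => //; apply: (measurableT_comp (@measurable_ln R)).
  apply: measurable_funD => //; apply: measurable_funM => //.
  apply: measurableT_comp => //; exact: measurable_funM.
by apply: measurable_maxr.
Qed.

Lemma measurable_dactivation s : 0 < s ->
  measurable_fun setT (dactivation s%:E).
Proof.
move=> s0; apply: continuous_measurable_fun => x.
have cE : {for x, continuous (fun y : R => expR (s * y))}.
  apply: continuous_comp; last exact: continuous_expR.
  by apply: cvgM => //; exact: cvg_cst.
apply: cvgM => //; apply: cvgV; first by rewrite gt_eqF// addr_gt0// expR_gt0.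
by apply: cvgD => //; exact: cvg_cst.
Qed.

End activation.

(** * Stability of boundedness under sums and products *)

Section bounded_on.
Context {R : realType} {T : Type}.
Implicit Types (D : set T) (f g : T -> R).

Definition bounded_on D f := exists C, forall t, D t -> `|f t| <= C.

Lemma bounded_on_cst D (c : R) : bounded_on D (fun=> c).
Proof. by exists `|c|. Qed.

Lemma bounded_onD D f g :
  bounded_on D f -> bounded_on D g -> bounded_on D (fun t => f t + g t).
Proof.
move=> [A fA] [B gB]; exists (A + B) => t Dt.
by rewrite (le_trans (ler_normD _ _))// lerD ?fA ?gB.
Qed.

Lemma bounded_onM D f g :
  bounded_on D f -> bounded_on D g -> bounded_on D (fun t => f t * g t).
Proof.
move=> [A fA] [B gB]; exists (A * B) => t Dt.
by rewrite normrM ler_pM ?fA ?gB.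
Qed.

Lemma bounded_on_sum D (I : Type) (s : seq I) (F : I -> T -> R) :
  (forall i, bounded_on D (F i)) ->
  bounded_on D (fun t => \sum_(i <- s) F i t).
Proof.
move=> bF; elim: s => [|i s ih].
  by under eq_fun do rewrite big_nil; exact: bounded_on_cst.
by under eq_fun do rewrite big_cons; exact: bounded_onD.
Qed.

End bounded_on.

(** * Integration of bounded functions over the unit interval *)

Section unit_interval_integral.
Context {R : realType}.
Local Notation mu := (@lebesgue_measure R).

Lemma bounded_integrable01 (f : R -> R) (C : R) :
  measurable_fun setT f -> (forall y, 0 <= y <= 1 -> `|f y| <= C) ->
  mu.-integrable `[0, 1] (EFin \o f).
Proof.
move=> mf fC; apply: measurable_bounded_integrable => //.
- by rewrite /= lebesgue_measure_itv/= lte01 oppr0 adde0 ltry.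
- exact: measurable_funTS.
- exists C; split; first exact: num_real.
  by move=> M CM y /=; rewrite in_itv/= => /fC /le_trans; apply; exact: ltW.
Qed.

(** Dominated convergence with a constant majorant, integrable because the interval has finite
    measure. Integrability of the limit is kept in the conclusion for the later use of linearity of
    the integral. *)
Lemma cvg_Rintegral01 (f_ : nat -> R -> R) (f : R -> R) (C : R) :
  (forall n, measurable_fun setT (f_ n)) ->
  (forall y, f_ n y @[n --> \oo] --> f y) ->
  (forall n y, 0 <= y <= 1 -> `|f_ n y| <= C) ->
  mu.-integrable `[0, 1] (EFin \o f) /\
  \int[mu]_(y in `[0, 1]) f_ n y @[n --> \oo] --> \int[mu]_(y in `[0, 1]) f y.
Proof.
move=> mf_ f_f f_C.
have mf : measurable_fun setT f.
  by apply: (@measurable_fun_cvg _ _ _ _ f_) => //= y _; exact: f_f.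
have intC : mu.-integrable `[0, 1] (EFin \o cst `|C|).
  by apply: (@bounded_integrable01 _ `|C|) => // y _; rewrite /= normr_id.
have [] := @dominated_convergence _ _ _ mu `[0, 1] _ (fun n => EFin \o f_ n)
  (EFin \o f) (EFin \o cst `|C|) _ _ _ intC _ => //.
- by move=> n; apply/measurable_EFinP; apply: measurable_funTS; exact: mf_.
- by apply/measurable_EFinP; apply: measurable_funTS; exact: mf.
- by apply: aeW => y _; apply: cvg_EFin; [exact: nearW | exact: f_f].
- apply: aeW => y n /=; rewrite in_itv/= => /f_C fC.
  by rewrite lee_fin (le_trans (fC _))// ler_norm.
move=> intf _ If; split=> //; apply: fine_cvg.
rewrite fineK//; exact: integrable_fin_num.
Qed.

End unit_interval_integral.

(** * The network along a line in parameter space *)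

Section network.
Context {R : realType} {H : nat}.
Notation vec := 'rV[R]_(3 * H).+1.
Implicit Types (phi v : vec) (r : \bar R) (s h y : R).

Definition preactivation phi (j : nat) y : R :=
  coordinate phi j * y + coordinate phi (H + j).

(** The directional derivative of the network at [phi] along [v] as the product and chain rules give
    it. At [+oo] it is a formal expression, with [dactivation] standing in for the derivative of the
    ReLU. *)
Definition dnetwork r phi v y : R :=
  coordinate v (3 * H + 1)
  + \sum_(1 <= j < H.+1)
      (coordinate v (2 * H + j) * activation r (preactivation phi j y)
       + coordinate phi (2 * H + j)
         * (dactivation r (preactivation phi j y) * preactivation v j y)).

Lemma coordinateD a phi v k :
  coordinate (a *: v + phi) k = a * coordinate v k + coordinate phi k.
Proof. by rewrite /coordinate !mxE. Qed.

Lemma preactivationD a phi v j y :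
  preactivation (a *: v + phi) j y = a * preactivation v j y + preactivation phi j y.
Proof. rewrite /preactivation !coordinateD; ring. Qed.

Lemma dnetwork_linear r phi a u v y :
  dnetwork r phi (a *: u + v) y = a * dnetwork r phi u y + dnetwork r phi v y.
Proof.
rewrite /dnetwork coordinateD.
under eq_bigr => j _.
  rewrite coordinateD preactivationD.
  rewrite (_ : _ + _ = a *
      (coordinate u (2 * H + j) * activation r (preactivation phi j y)
       + coordinate phi (2 * H + j)
         * (dactivation r (preactivation phi j y) * preactivation u j y)) +
      (coordinate v (2 * H + j) * activation r (preactivation phi j y)
       + coordinate phi (2 * H + j)
         * (dactivation r (preactivation phi j y) * preactivation v j y))); last by ring.
  over.
rewrite big_split/= -mulr_sumr; ring.
Qed.

(** The derivative is taken at every [h], not only at 0, since differentiation under the integral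
    sign works on a neighbourhood of 0. *)
Lemma is_derive_network s phi v y h : 0 < s ->
  is_derive h 1 (fun t : R => network s%:E (t *: v + phi) y)
    (dnetwork s%:E (h *: v + phi) v y).
Proof.
move=> s0; rewrite /network /dnetwork.
apply: is_deriveD.
  under eq_fun do rewrite coordinateD.
  exact: is_derive_affine.
apply: is_derive_bigsum => j.
have dc : is_derive h 1 (fun t : R => coordinate (t *: v + phi) (2 * H + j))
    (coordinate v (2 * H + j)).
  by under eq_fun do rewrite coordinateD; exact: is_derive_affine.
have dz : is_derive h 1 (fun t : R => preactivation (t *: v + phi) j y)
    (preactivation v j y).
  by under eq_fun do rewrite preactivationD; exact: is_derive_affine.
have da : is_derive h 1
    (activation s%:E \o (fun t : R => preactivation (t *: v + phi) j y))
    (dactivation s%:E (preactivation (h *: v + phi) j y) * preactivation v j y).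
  by apply: is_derive1_comp; exact: is_derive_activation.
apply: (is_derive_eq (is_deriveM dc da)).
rewrite /GRing.scale/=; ring.
Qed.

Lemma measurable_preactivation phi j : measurable_fun setT (preactivation phi j).
Proof. by apply: measurable_funD => //; exact: measurable_funM. Qed.

Lemma measurable_network r phi : measurable_fun setT (network r phi).
Proof.
apply: measurable_funD => //; apply: measurable_sum => j.
apply: measurable_funM => //.
apply: (measurableT_comp (measurable_activation r)).
exact: measurable_preactivation.
Qed.

Lemma measurable_dnetwork s phi v : 0 < s -> measurable_fun setT (dnetwork s%:E phi v).
Proof.
move=> s0; apply: measurable_funD => //; apply: measurable_sum => j.
have mz w := measurable_preactivation w j.
apply: measurable_funD; apply: measurable_funM => //.
  exact: (measurableT_comp (measurable_activation s%:E)).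
apply: measurable_funM => //.
exact: (measurableT_comp (measurable_dactivation _ s0)).
Qed.

Lemma cvg_network phi y :
  network (n.+1%:R)%:E phi y @[n --> \oo] --> network +oo%E phi y.
Proof.
apply: cvgD; first exact: cvg_cst.
apply: cvg_sumr => j; apply: cvgM; first exact: cvg_cst.
exact: cvg_activation.
Qed.

Lemma cvg_dnetwork phi v y :
  dnetwork (n.+1%:R)%:E phi v y @[n --> \oo] --> dnetwork +oo%E phi v y.
Proof.
apply: cvgD; first exact: cvg_cst.
apply: cvg_sumr => j; apply: cvgD; apply: cvgM; try exact: cvg_cst.
  exact: cvg_activation.
by apply: cvgM; [exact: cvg_dactivation | exact: cvg_cst].
Qed.

(* The points of [dom] are the triples (s, h, y). *)
Let dom : set (R * R * R) :=
  [set t | [/\ 1 <= t.1.1, -1 <= t.1.2 <= 1 & 0 <= t.2 <= 1]].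

Let bounded_coordinate phi v k :
  bounded_on dom (fun t => coordinate (t.1.2 *: v + phi) k).
Proof.
under eq_fun do rewrite coordinateD.
apply: bounded_onD; last exact: bounded_on_cst.
apply: bounded_onM; last exact: bounded_on_cst.
by exists 1 => t [_ + _]; rewrite -ler_norml.
Qed.

Let bounded_preactivation phi v j :
  bounded_on dom (fun t => preactivation (t.1.2 *: v + phi) j t.2).
Proof.
apply: bounded_onD; last exact: bounded_coordinate.
apply: bounded_onM; first exact: bounded_coordinate.
by exists 1 => t [_ _ /andP[t0 t1]]; rewrite ger0_norm.
Qed.

Let bounded_activation phi v j :
  bounded_on dom
    (fun t => activation t.1.1%:E (preactivation (t.1.2 *: v + phi) j t.2)).
Proof.
have [C zC] := bounded_preactivation phi v j.
exists (C + 3) => t Dt; have [t1 _ _] := Dt.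
by rewrite (le_trans (activation_le _ _ t1))// lerD2r zC.
Qed.

(** One constant serves all indices, all steps along the line and all inputs, so it can dominate
    both when [h] varies and when the index tends to infinity. *)
Lemma network_bounded phi v : exists C, forall s h y,
  1 <= s -> -1 <= h <= 1 -> 0 <= y <= 1 ->
  `|network s%:E (h *: v + phi) y| <= C.
Proof.
have [C dC] : bounded_on dom (fun t => network t.1.1%:E (t.1.2 *: v + phi) t.2).
  apply: bounded_onD => //; apply: bounded_on_sum => j.
  by apply: bounded_onM => //; exact: bounded_activation.
by exists C => s h y s1 h1 y1; exact: (dC (s, h, y)).
Qed.

Lemma dnetwork_bounded phi v : exists C, forall s h y,
  1 <= s -> -1 <= h <= 1 -> 0 <= y <= 1 ->
  `|dnetwork s%:E (h *: v + phi) v y| <= C.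
Proof.
have [C dC] : bounded_on dom (fun t => dnetwork t.1.1%:E (t.1.2 *: v + phi) v t.2).
  apply: bounded_onD; first exact: bounded_on_cst.
  apply: bounded_on_sum => j; apply: bounded_onD; apply: bounded_onM => //.
    exact: bounded_on_cst.
  apply: bounded_onM.
    exists 1 => t [t1 _ _].
    have /(dactivation_ge0_le1 _) : 0 < t.1.1 by rewrite (lt_le_trans _ t1).
    by move=> /(_ (preactivation (t.1.2 *: v + phi) j t.2))/andP[? ?]; rewrite ger0_norm.
  (* Base point [v] with direction 0: the bound along a line becomes one for the direction
     itself. *)
  have := bounded_preactivation v 0 j.
  by under eq_fun do rewrite scaler0 add0r.
by exists C => s h y s1 h1 y1; exact: (dC (s, h, y)).
Qed.

(** * Differentiation of the risk under the integral sign *)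

Variable alpha : R.
Local Notation mu := (@lebesgue_measure R).

Definition drisk_integrand r phi v y : R :=
  2 * (network r phi y - alpha) * dnetwork r phi v y.

Lemma drisk_integrand_bounded phi v : exists C, forall s h y,
  1 <= s -> -1 <= h <= 1 -> 0 <= y <= 1 ->
  `|drisk_integrand s%:E (h *: v + phi) v y| <= C.
Proof.
have [A nA] := network_bounded phi v; have [B dB] := dnetwork_bounded phi v.
exists (2 * (A + `|alpha|) * B) => s h y s1 h1 y1.
rewrite /drisk_integrand !normrM ler_pM ?mulr_ge0 ?dB//.
rewrite normr_nat ler_wpM2l// (le_trans (ler_normB _ _))// lerD2r nA//.
Qed.

Lemma measurable_drisk_integrand s phi v :
  0 < s -> measurable_fun setT (drisk_integrand s%:E phi v).
Proof.
move=> s0; apply: measurable_funM; last exact: measurable_dnetwork.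
by apply: measurable_funM => //; apply: measurable_funB => //; exact: measurable_network.
Qed.

(** The squared error is differentiable in [h] on the open interval from -1 to 1, with derivative
    bounded there by a constant; the claim is the resulting formula at [h] = 0. *)
Lemma derive_risk s phi v : 1 <= s ->
  'D_v (risk alpha s%:E) phi = \int[mu]_(y in `[0, 1]) drisk_integrand s%:E phi v y.
Proof.
move=> s1; have s0 : 0 < s by rewrite (lt_le_trans _ s1).
pose f h y := (network s%:E (h *: v + phi) y - alpha) ^+ 2.
have df h y : is_derive h 1 (f ^~ y) (drisk_integrand s%:E (h *: v + phi) v y).
  have dN := is_derive_network s phi v y h s0.
  have dB := is_deriveB dN (is_derive_cst alpha h 1).
  apply: (is_derive_eq (is_deriveX 2 dB)).
  by rewrite /drisk_integrand /GRing.scale/= subr0 expr1.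
have d1f h y : partial1of2 f h y = drisk_integrand s%:E (h *: v + phi) v y.
  by rewrite partial1of2E; apply: derive_val.
have [A nA] := network_bounded phi v.
have [C dC] := drisk_integrand_bounded phi v.
(* [C] bounds an absolute value at the sample point [h] = 0, [y] = 0. *)
have C0 : 0 <= C.
  by apply: le_trans (dC s 0 0 s1 _ _); rewrite ?normr_ge0 ?lexx ?ler01 ?oppr_le0 ?ler01.
have hI h : `]-1, 1[%classic h -> -1 <= h <= 1.
  by rewrite /= in_itv/= => /andP[/ltW-> /ltW->].
have intf h : `]-1, 1[%classic h -> mu.-integrable `[0, 1] (EFin \o f h).
  move=> h1; apply: (bounded_integrable01 _ ((A + `|alpha|) ^+ 2)).
    by apply: measurable_funX; apply: measurable_funB => //; exact: measurable_network.
  move=> y y1; rewrite normrX lerXn2r ?nnegrE//.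
    by rewrite addr_ge0// (le_trans _ (nA s h y s1 (hI _ h1) y1)).
  by rewrite (le_trans (ler_normB _ _))// lerD2r nA// hI.
have int1 : mu.-integrable `[0, 1] (EFin \o cst C).
  apply: (bounded_integrable01 _ C) => // y _; by rewrite /= ger0_norm.
have I0 : `]-1, 1[%classic (0 : R) by rewrite /= in_itv/= ltrN10 ltr01.
have D : derive1 (fun h : R => \int[mu]_(y in `[0, 1]) f h y) 0 =
    \int[mu]_(y in `[0, 1]) partial1of2 f 0 y.
  apply: (@differentiation_under_integral _ _ _ mu f `[0, 1] _ 0 (-1) 1 I0
    intf _ (cst C) _ int1) => //.
  by move=> h y h1; rewrite /= in_itv/= => y1; rewrite d1f dC// hI.
rewrite derive_line -derive1E [LHS]D.
by apply: eq_Rintegral => y _; rewrite d1f scale0r add0r.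
Qed.

End network.

(** * The limit of the gradients as a linear functional *)

Section limit_gradient.
Context {R : realType} {H : nat} (alpha : R).
Notation vec := 'rV[R]_(3 * H).+1.
Implicit Types (phi v : vec) (r : \bar R).
Local Notation mu := (@lebesgue_measure R).

Lemma cvg_Rintegral_drisk phi v :
  mu.-integrable `[0, 1] (EFin \o drisk_integrand alpha +oo%E phi v) /\
  \int[mu]_(y in `[0, 1]) drisk_integrand alpha (n.+1%:R)%:E phi v y
    @[n --> \oo] --> \int[mu]_(y in `[0, 1]) drisk_integrand alpha +oo%E phi v y.
Proof.
have [C dC] := drisk_integrand_bounded alpha phi v.
apply: (@cvg_Rintegral01 _ _ _ C) => [n|y|n y y1].
- by apply: measurable_drisk_integrand; rewrite ltr0n.
- apply: cvgM; last exact: cvg_dnetwork.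
  apply: cvgM; first exact: cvg_cst.
  by apply: cvgB; [exact: cvg_network | exact: cvg_cst].
(* Writing [phi] as [0 *: v + phi] makes the bound along the line applicable at [h] = 0. *)
- rewrite -[phi]add0r -(scale0r v) dC ?ler1n ?ler01 ?andbT//.
Qed.

(** The ReLU squared error is a bounded pointwise limit of the smooth ones. Its integrability is
    what allows a constant factor to leave the integral in the final identity. *)
Lemma integrable_sqr_error phi :
  mu.-integrable `[0, 1] (EFin \o (fun y => (network +oo%E phi y - alpha) ^+ 2)).
Proof.
have [C nC] := network_bounded phi 0.
have [] // := @cvg_Rintegral01 _
  (fun n y => (network (n.+1%:R)%:E phi y - alpha) ^+ 2)
  (fun y => (network +oo%E phi y - alpha) ^+ 2) ((C + `|alpha|) ^+ 2).
- move=> n; apply: measurable_funX; apply: measurable_funB => //.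
  exact: measurable_network.
- move=> y; have d : network (n.+1%:R)%:E phi y - alpha @[n --> \oo] -->
      network +oo%E phi y - alpha.
    by apply: cvgB; [exact: cvg_network | exact: cvg_cst].
  by apply: cvgM.
- move=> n y y1; have := nC n.+1%:R 0 y.
  rewrite scaler0 add0r ler1n oppr_le0 ler01 => /(_ isT isT y1) {}nC.
  rewrite normrX lerXn2r ?nnegrE ?normr_ge0//.
    by rewrite addr_ge0// (le_trans _ nC).
  by rewrite (le_trans (ler_normB _ _))// lerD2r.
Qed.

(* The limit of the derivatives along v of the smooth risks; it need not be a
   directional derivative of the ReLU risk. *)
Definition limit_derivative phi v : R :=
  \int[mu]_(y in `[0, 1]) drisk_integrand alpha +oo%E phi v y.

Lemma limit_derivative_linear phi a u v :
  limit_derivative phi (a *: u + v) =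
  a * limit_derivative phi u + limit_derivative phi v.
Proof.
have [iu _] := cvg_Rintegral_drisk phi u.
have [iv _] := cvg_Rintegral_drisk phi v.
rewrite /limit_derivative -RintegralZl// -RintegralD//; last first.
  exact: (@integrableZl _ _ _ mu _ _ a _ iu).
apply: eq_Rintegral => y _.
rewrite /drisk_integrand dnetwork_linear; ring.
Qed.

Lemma limit_derivative_sum phi (I : Type) (l : seq I) (a : I -> R) (e : I -> vec) :
  limit_derivative phi (\sum_(i <- l) a i *: e i) =
  \sum_(i <- l) a i * limit_derivative phi (e i).
Proof.
elim: l => [|i l ih]; last by rewrite !big_cons limit_derivative_linear ih.
(* The empty sum needs the value at the zero vector to vanish, which is linearity with factor -1 and
   both vectors 0. *)
have := limit_derivative_linear phi (-1) 0 0.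
by rewrite !big_nil scaler0 addr0 mulN1r addNr.
Qed.

(** Expansion in the standard basis reduces convergence of vectors to convergence of each partial
    derivative. *)
Lemma cvg_grad_risk phi :
  grad (risk alpha (n.+1%:R)%:E) phi @[n --> \oo] -->
  \row_i limit_derivative phi (delta_mx 0 i).
Proof.
have E (u : vec) : u = \sum_(i <- enum 'I_(3 * H).+1) u 0 i *: delta_mx 0 i.
  by rewrite big_enum -row_sum_delta.
rewrite [X in _ --> X]E; under eq_fun do rewrite [grad _ _]E.
apply: cvg_sumr => i; apply: cvgZ; last exact: cvg_cst.
rewrite mxE; under eq_fun do rewrite mxE derive_risk ?ler1n//.
by have [] := cvg_Rintegral_drisk phi (delta_mx 0 i).
Qed.

(** The gradients converge at every [phi], so the hypothesis determines [G phi] coordinate by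
    coordinate; expanding [u] in the basis reassembles the linear functional. *)
Lemma inner_generalized_gradient (G : vec -> vec) phi u :
  generalized_gradient alpha G -> inner u (G phi) = limit_derivative phi u.
Proof.
move=> hG; have gG := cvg_grad_risk phi.
have -> : G phi = \row_i limit_derivative phi (delta_mx 0 i).
  rewrite hG; first exact: cvg_lim gG.
  by apply/cvg_ex; eexists; exact: gG.
rewrite /inner [in RHS](row_sum_delta u) limit_derivative_sum.
by apply: eq_bigr => i _; rewrite mxE.
Qed.

(** Euler's identity for the ReLU, positively homogeneous of degree 1; at the kink both sides
    vanish. *)
Lemma dactivation_homogeneous (x : R) :
  dactivation +oo%E x * x = activation +oo%E x.
Proof.
rewrite /= maxC /Num.max; case: (ltP 0 x) => _; by rewrite ?mul1r ?mul0r.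
Qed.

(** In each summand the outer weight contributes the factor a and, by homogeneity, the inner
    parameters contribute b. Only the sum a + b survives, so different distributions of weight give
    the same multiple of the error. *)
Lemma dnetwork_scaled phi u a b y :
  coordinate u (3 * H + 1) = (a + b) * (coordinate phi (3 * H + 1) - alpha) ->
  (forall j, (1 <= j < H.+1)%N ->
    [/\ coordinate u (2 * H + j) = a * coordinate phi (2 * H + j),
        coordinate u j = b * coordinate phi j
      & coordinate u (H + j) = b * coordinate phi (H + j)]) ->
  dnetwork +oo%E phi u y = (a + b) * (network +oo%E phi y - alpha).
Proof.
move=> uc uj; rewrite /dnetwork uc.
rewrite (eq_big_nat _ _ (F2 := fun j => (a + b) * (coordinate phi (2 * H + j)
      * activation +oo%E (coordinate phi j * y + coordinate phi (H + j))))).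
  by rewrite -mulr_sumr /network; ring.
move=> j /uj[-> uj1 uj2].
have -> : preactivation u j y = b * preactivation phi j y.
  by rewrite /preactivation uj1 uj2; ring.
rewrite -/(preactivation phi j y) -dactivation_homogeneous; ring.
Qed.

End limit_gradient.

(** * Gradients of diagonal quadratic functions *)

Section quadratic_gradient.
Context {R : realType} {H : nat}.
Notation vec := 'rV[R]_(3 * H).+1.
Implicit Types (phi u v : vec).

(** The four blocks are the inner weights, the inner biases, the outer weights and the outer
    bias. *)
Lemma sum_coordinates_split (F : nat -> R) :
  \sum_(1 <= k < (3 * H).+2) F k =
  \sum_(1 <= j < H.+1) (F j + F (H + j)%N + F (2 * H + j)%N) + F (3 * H + 1)%N.
Proof.
have shift a : \sum_(a.+1 <= k < (a + H).+1) F k = \sum_(1 <= j < H.+1) F (a + j)%N.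
  rewrite -[a.+1]add1n big_addn (_ : _ - a = H.+1)%N; last by lia.
  by apply: eq_bigr => j _; rewrite addnC.
rewrite big_nat_recr//= addn1; congr (_ + _).
rewrite (big_cat_nat (n := H.+1))//=; last by lia.
rewrite (big_cat_nat (m := H.+1) (n := (H + H).+1))//=; [|lia|lia].
rewrite !big_split/= addrA (shift H); congr (_ + _ + _).
rewrite -(shift (2 * H)%N); congr (\sum_(_ <= k < _) _); lia.
Qed.

(** The range conditions keep [inord] faithful: too large an index falls back to 0, and the
    predecessor identifies 0 with 1. *)
Lemma coordinate_delta (a b : nat) :
  (1 <= a < (3 * H).+2)%N -> (1 <= b < (3 * H).+2)%N ->
  coordinate (delta_mx 0 (inord a.-1) : vec) b = (b == a)%:R.
Proof.
move=> a1 b1; rewrite /coordinate mxE eqxx/=; congr (_%:R).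
rewrite -val_eqE/= !inordK; lia.
Qed.

(** Along a basis direction [f] is a polynomial in one variable, and only the k-th square and
    possibly the linear term in the outer bias contribute to its derivative at 0. *)
Lemma coordinate_grad_quadratic (f : vec -> R) (w : nat -> R) (b c : R) phi k :
  (forall psi, f psi = \sum_(1 <= i < (3 * H).+2) w i * coordinate psi i ^+ 2
     - 2 * b * coordinate psi (3 * H + 1) + c) ->
  (1 <= k < (3 * H).+2)%N ->
  coordinate (grad f phi) k =
    2 * (w k * coordinate phi k - b * (k == 3 * H + 1)%N%:R).
Proof.
move=> fE k1; rewrite {1}/coordinate mxE derive_line.
set v := delta_mx _ _.
have dq (i : nat) : is_derive (0 : R) 1
    (fun t : R => w i * coordinate (t *: v + phi) i ^+ 2)
    (w i * (2 * coordinate phi i * coordinate v i)).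
  under eq_fun do rewrite coordinateD.
  have d := is_deriveX 2 (is_derive_affine (coordinate v i) (coordinate phi i) 0).
  apply: (is_derive_eq (is_deriveZ (w i) d)).
  by rewrite /GRing.scale/= mul0r add0r expr1.
have db : is_derive (0 : R) 1
    (fun t : R => - 2 * b * coordinate (t *: v + phi) (3 * H + 1) + c)
    (- 2 * b * coordinate v (3 * H + 1)).
  under eq_fun do rewrite coordinateD.
  have d := is_derive_affine (coordinate v (3 * H + 1)) (coordinate phi (3 * H + 1)) 0.
  apply: (is_derive_eq (is_deriveD
    (is_deriveZ (- 2 * b) d) (is_derive_cst c (0 : R) (1 : R)))).
  by rewrite /GRing.scale/= addr0.
have -> : (fun t : R => f (t *: v + phi)) =
    (fun t => \sum_(1 <= i < (3 * H).+2) w i * coordinate (t *: v + phi) i ^+ 2)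
    + (fun t => - 2 * b * coordinate (t *: v + phi) (3 * H + 1) + c).
  by apply/funext => t; rewrite fE !fctE; ring.
have dsum := is_derive_bigsum _ (index_iota 1 (3 * H).+2) _ _ _ dq.
rewrite (@derive_val _ _ _ _ _ _ _ (is_deriveD dsum db)).
rewrite coordinate_delta//; last by lia.
rewrite (bigD1_seq k) ?mem_index_iota ?iota_uniq//= big1_seq ?addr0.
  by rewrite coordinate_delta// eqxx mulr1n (eq_sym k); ring.
move=> i /andP[ik]; rewrite mem_index_iota => i1.
by rewrite coordinate_delta// (negbTE ik) !mulr0.
Qed.

End quadratic_gradient.

(** * The identity for weighted quadratic functions and its three instances *)

(** The gradient of [f] scales the outer weights by 2a and the inner parameters by 2b, and its last
    entry is 2(a + b)(c' - alpha), where c' is the outer bias. Homogeneity then makes the integrand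
    2(N - alpha) times 2(a + b)(N - alpha). *)
Lemma inner_grad_weighted (R : realType) (H : nat) (alpha : R)
    (G : 'rV[R]_(3 * H).+1 -> 'rV[R]_(3 * H).+1) (f : 'rV[R]_(3 * H).+1 -> R)
    (a b c : R) (phi : 'rV[R]_(3 * H).+1) :
  generalized_gradient alpha G ->
  (forall psi, f psi =
    (a + b) * (coordinate psi (3 * H + 1) ^+ 2 - 2 * alpha * coordinate psi (3 * H + 1))
    + \sum_(1 <= j < H.+1) (b * coordinate psi j ^+ 2 + b * coordinate psi (H + j) ^+ 2
                            + a * coordinate psi (2 * H + j) ^+ 2) + c) ->
  inner (grad f phi) (G phi) = 4 * (a + b) * risk alpha +oo%E phi.
Proof.
move=> hG fE; rewrite (inner_generalized_gradient alpha)//.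
(* The weight is constant on blocks; the last value concerns the outer bias, at index 3H + 1. *)
pose w k := if (k <= 2 * H)%N then b else if (k <= 3 * H)%N then a else a + b.
have fq psi : f psi = \sum_(1 <= i < (3 * H).+2) w i * coordinate psi i ^+ 2
     - 2 * ((a + b) * alpha) * coordinate psi (3 * H + 1) + c.
  rewrite fE sum_coordinates_split {4}/w !ifN; try lia.
  under [in RHS]eq_big_nat => j j1.
    rewrite /w ifT; last by lia.
    rewrite ifT; last by lia.
    rewrite ifN; last by lia.
    rewrite ifT; last by lia.
    over.
  ring.
have gE k (k1 : (1 <= k < (3 * H).+2)%N) := coordinate_grad_quadratic f w _ c phi k fq k1.
have dE y : dnetwork +oo%E phi (grad f phi) y =
    (2 * a + 2 * b) * (network +oo%E phi y - alpha).
  apply: dnetwork_scaled => [|j j1]; last split.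
  - rewrite gE; last by lia.
    by rewrite /w !ifN ?eqxx ?mulr1n; [ring | lia | lia].
  - rewrite gE; last by lia.
    rewrite /w ifN ?ifT; [|lia|lia].
    by rewrite (_ : (_ == _) = false) ?mulr0 ?subr0 ?mulrA//; apply/eqP; lia.
  - rewrite gE; last by lia.
    rewrite /w ifT; last by lia.
    by rewrite (_ : (_ == _) = false) ?mulr0 ?subr0 ?mulrA//; apply/eqP; lia.
  - rewrite gE; last by lia.
    rewrite /w ifT; last by lia.
    by rewrite (_ : (_ == _) = false) ?mulr0 ?subr0 ?mulrA//; apply/eqP; lia.
rewrite /limit_derivative /risk -RintegralZl//; last exact: integrable_sqr_error.
apply: eq_Rintegral => y _; rewrite /drisk_integrand dE; ring.
Qed.

(** With c the outer bias, c^2 + (c - 2 alpha)^2 = 2(c^2 - 2 alpha c) + 4 alpha^2, so this is the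
    weighted form with a = b = 1 up to a constant. *)
Lemma lyapunovE (R : realType) (H : nat) (alpha : R) (phi : 'rV[R]_(3 * H).+1) :
  lyapunov alpha phi =
    (1 + 1) * (coordinate phi (3 * H + 1) ^+ 2 - 2 * alpha * coordinate phi (3 * H + 1))
    + \sum_(1 <= j < H.+1) (1 * coordinate phi j ^+ 2 + 1 * coordinate phi (H + j) ^+ 2
                            + 1 * coordinate phi (2 * H + j) ^+ 2) + 4 * alpha ^+ 2.
Proof.
have -> : lyapunov alpha phi = \sum_(1 <= k < (3 * H).+2) coordinate phi k ^+ 2
    + (coordinate phi (3 * H + 1) - 2 * alpha) ^+ 2.
  rewrite /lyapunov /enorm sqr_sqrtr; last first.
    by apply: sumr_ge0 => i _; rewrite -expr2 sqr_ge0.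
  congr (_ + _); rewrite big_add1/= big_mkord; apply: eq_bigr => i _.
  by rewrite /coordinate/= inord_val expr2.
rewrite sum_coordinates_split; under [in RHS]eq_bigr do rewrite !mul1r.
ring.
Qed.

Theorem proposition2p14 (R : realType) (H : nat) (H_gt0 : (0 < H)%N) (alpha : R)
    (G : 'rV[R]_(3 * H).+1 -> 'rV[R]_(3 * H).+1)
    (hG : generalized_gradient alpha G)
    (V1 V2 : 'rV[R]_(3 * H).+1 -> R)
    (V1_cont : continuous V1) (V2_cont : continuous V2)
    (hV1 : forall phi : 'rV[R]_(3 * H).+1,
      V1 phi = coordinate phi (3 * H + 1) ^+ 2 - 2 * alpha * coordinate phi (3 * H + 1)
        + \sum_(1 <= j < H.+1) coordinate phi (2 * H + j) ^+ 2)
    (hV2 : forall phi : 'rV[R]_(3 * H).+1,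
      V2 phi = coordinate phi (3 * H + 1) ^+ 2 - 2 * alpha * coordinate phi (3 * H + 1)
        + \sum_(1 <= j < H.+1) (coordinate phi j ^+ 2 + coordinate phi (H + j) ^+ 2))
    (phi : 'rV[R]_(3 * H).+1) :
  [/\ inner (grad V1 phi) (G phi) = 4 * risk alpha +oo%E phi,
      inner (grad V2 phi) (G phi) = 4 * risk alpha +oo%E phi &
      inner (grad (lyapunov alpha) phi) (G phi) = 8 * risk alpha +oo%E phi].
Proof.
(* The weights (a, b) are (1, 0), (0, 1) and (1, 1), so the factor 4(a + b) is 4, 4 and 8. *)
split.
- rewrite (@inner_grad_weighted _ _ alpha G V1 1 0 0)//; first by ring.
  move=> psi; rewrite hV1 addr0; congr (_ + _); first by ring.
  by apply: eq_bigr => j _; ring.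
- rewrite (@inner_grad_weighted _ _ alpha G V2 0 1 0)//; first by ring.
  move=> psi; rewrite hV2 addr0; congr (_ + _); first by ring.
  by apply: eq_bigr => j _; ring.
- rewrite (@inner_grad_weighted _ _ alpha G _ 1 1 (4 * alpha ^+ 2))//; first by ring.
  exact: lyapunovE.
Qed.
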